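(* Let $\Lambda:\mathbb{R}\to[0,1]$ be a right continuous function that is either increasing with $\sup_{x}\Lambda(x)<1$, or decreasing with $\inf_{x}\Lambda(x)<1$. Then $\Lambda V@R$ is a well-defined map $\mathcal{P}(\mathbb{R})\to\mathbb{R}\cup\{+\infty\}$ which is monotone decreasing ($P\preccurlyeq Q$ implies $\Lambda V@R(P)\ge\Lambda V@R(Q)$), quasi-convex ($\Lambda V@R(\lambda P+(1-\lambda)Q)\le\Lambda V@R(P)\vee\Lambda V@R(Q)$ for $\lambda\in[0,1]$) and continuous from above (if $P_n\downarrow P$ then $\Lambda V@R(P_n)\uparrow\Lambda V@R(P)$).
   Context: $\mathcal{P}(\mathbb{R})$ is the set of Borel probability measures on $\mathbb{R}$, and $F_P(x)=P(-\infty,x]$. First order stochastic dominance: $Q\preccurlyeq P$ iff $F_P(x)\le F_Q(x)$ for all $x$. For $\Lambda:\mathbb{R}\to[0,1]$ and $m\in\mathbb{R}$ set $F_m(x):=\Lambda(x)\mathbf{1}_{(-\infty,m)}(x)+\mathbf{1}_{[m,+\infty)}(x)$ and define $\Lambda V@R(P):=-\sup\{m\in\mathbb{R}\mid F_P(x)\le F_m(x)\ \forall x\in\mathbb{R}\}$, with $\sup\emptyset=-\infty$. $P_n\downarrow P$ means: $F_{P_n}(x)\le F_{P_{n+1}}(x)$ for all $x\in\mathbb{R}$ and all $n$, and $F_{P_n}(x)\uparrow F_P(x)$ for every continuity point $x$ of $F_P$. ''Increasing'' and ''decreasing'' are meant in the weak sense. *)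

(* Defs.v *)
From HB Require Import structures.
From mathcomp Require Import all_boot all_order all_algebra.
From mathcomp Require Import all_classical all_reals all_analysis.
Set Implicit Arguments.
Unset Strict Implicit.
Unset Printing Implicit Defensive.
Import Order.TTheory GRing.Theory Num.Theory.
Import numFieldNormedType.Exports.
Local Open Scope classical_set_scope.
Local Open Scope ring_scope.

Definition borel_prob (R : realType) := probability (measurableTypeR R) R.

(* [fine] loses nothing here: [P A] is finite for a probability [P]. *)
Definition distr_fun (R : realType) (P : borel_prob R) (x : R) : R :=
  fine (P `]-oo, x]%classic).

(* Q precedes P when F_P <= F_Q: the distribution functions are compared in the
   reverse order. *)
Definition fosd (R : realType) (Q P : borel_prob R) : Prop :=
  forall x, distr_fun P x <= distr_fun Q x.

Definition lvar_bound (R : realType) (L : R -> R) (m x : R) : R :=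
  L x * \1_(`]-oo, m[) x + \1_(`[m, +oo[) x.

(* The admissible [m] are embedded in the extended reals because [sup] on [R]
   is junk on empty or unbounded sets; [ereal_sup set0] is [-oo], so the value is
   [+oo] when no [m] is admissible. *)
Definition LambdaVaR (R : realType) (L : R -> R) (P : borel_prob R) : \bar R :=
  (- ereal_sup [set m%:E | m in
       [set m : R | forall x, (distr_fun P x <= lvar_bound L m x)%R]])%E.

Section mixture.
Context (R : realType) (t : {i01 R}) (P Q : borel_prob R).

Definition mixture : set (measurableTypeR R) -> \bar R :=
  measure_add (mscale t%:num%:nng P) (mscale (1 - t%:num)%:nng Q).

HB.instance Definition _ := Measure.on mixture.

Lemma mixtureE A :
  mixture A = (t%:num%:E * P A + (1 - t%:num)%:E * Q A)%E.
Proof. exact: measure_addE. Qed.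

Lemma mixture_setT : mixture setT = 1%E.
Proof. by rewrite mixtureE !probability_setT !mule1 -EFinD addrC subrK. Qed.

HB.instance Definition _ :=
  Measure_isProbability.Build _ _ _ mixture mixture_setT.

End mixture.

(* [P_] decreases to [P] for [fosd], so the distribution functions increase; the
   second clause need not restate monotonicity. *)
Definition decreasing_to (R : realType) (P_ : nat -> borel_prob R)
    (P : borel_prob R) : Prop :=
  (forall n x, distr_fun (P_ n) x <= distr_fun (P_ n.+1) x) /\
  (forall x, {for x, continuous (distr_fun P)} ->
     distr_fun (P_ n) x @[n --> \oo] --> distr_fun P x).

(* Main.v *)
(* [LambdaVaR L P] is minus the supremum of the set [A_P] of all [m] such that
   [F_P <= L] on [`]-oo, m[]. These sets are closed downwards, hence totally ordered
   by inclusion: one of [A_P], [A_Q] is contained in both, so in [A_(mixture t P Q)].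
   For continuity from above, an [m] lying strictly below every [sup A_(P_ n)] gives
   [F_(P_ n) <= L] on [`]-oo, m[] for all [n], hence [F_P <= L] at the continuity
   points of [F_P] below [m]; these are dense, and [F_P] and [L] are right
   continuous, so [m] belongs to [A_P]. *)
Require Import Defs.
From HB Require Import structures.
From mathcomp Require Import all_boot all_order all_algebra.
From mathcomp Require Import all_classical all_reals all_analysis.
Set Implicit Arguments.
Unset Strict Implicit.
Unset Printing Implicit Defensive.
Import Order.TTheory GRing.Theory Num.Theory.
Import numFieldNormedType.Exports.
Local Open Scope classical_set_scope.
Local Open Scope ring_scope.

(** Reals are dense in the extended reals: if [z < y], a real strictly between them refutes the
    hypothesis. *)
Lemma lee_from_below (R : realFieldType) (y z : \bar R) :
  (forall r : R, (r%:E < y -> r%:E <= z)%E) -> (y <= z)%E.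
Proof.
move=> yz; rewrite leNgt; apply/negP => zy.
case: z => [r| |] in yz zy; last 2 first.
- by move: zy; rewrite ltNge leey.
- case: y => [s| |] in yz zy.
  + by have := yz (s - 1); rewrite lte_fin gtrBl ltr01 leeNy_eq => /(_ isT).
  + by have := yz 0; rewrite ltry leeNy_eq => /(_ isT).
  + by rewrite ltxx in zy.
case: y => [s| |] in yz zy.
- rewrite lte_fin in zy.
  have := yz ((r + s) / 2); rewrite lte_fin midf_lt// lee_fin => /(_ isT).
  by rewrite leNgt midf_lt.
- have := yz (r + 1); rewrite ltry lee_fin => /(_ isT).
  by rewrite leNgt ltrDl ltr01.
- by move: zy; rewrite ltNge leNye.
Qed.

(** [discontinuity] means a jump: one-sided limits that exist and differ. For monotone [F] both
    exist and enclose [F r], so without a jump all three agree. *)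
Lemma nondecreasing_continuous_at (R : realType) (F : R -> R) (r : R) :
  nondecreasing_fun F -> ~ discontinuity F r -> {for r, continuous F}.
Proof.
move=> ndF nd; apply/left_right_continuousP.
have cl : cvg (F x @[x --> r^'-]).
  apply: nondecreasing_at_left_is_cvgr; near=> t.
    by move=> ? ? _ _; exact: ndF.
  by exists (F r) => _ [u /= /[!in_itv]/= /andP[_ ur] <-]; exact/ndF/ltW.
have cr : cvg (F x @[x --> r^'+]).
  apply: nondecreasing_at_right_is_cvgr; near=> t.
    by move=> ? ? _ _; exact: ndF.
  by exists (F r) => _ [u /= /[!in_itv]/= /andP[ru _] <-]; exact/ndF/ltW.
have lr : lim (F x @[x --> r^'-]) = lim (F x @[x --> r^'+]).
  by apply/eqP; apply: contra_notT nd => lr; split.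
have lF : lim (F x @[x --> r^'-]) <= F r.
  by apply: limr_le => //; near=> t; apply/ndF/ltW.
have Fr : F r <= lim (F x @[x --> r^'+]).
  by apply: limr_ge => //; near=> t; apply/ndF/ltW.
have lE : lim (F x @[x --> r^'-]) = F r.
  by apply/eqP; rewrite eq_le lF lr Fr.
by split; [rewrite -lE | rewrite -lE lr].
Unshelve. all: by end_near. Qed.

(** A monotone function has countably many jumps, a Lebesgue null set, whereas the interval has
    measure [b - a > 0]. *)
Lemma nondecreasing_continuity_dense (R : realType) (F : R -> R) (a b : R) :
  nondecreasing_fun F -> a < b ->
  exists2 r, r \in `]a, b[ & {for r, continuous F}.
Proof.
move=> ndF ab; apply: contrapT => /forall2NP nocont.
have : countable [set x | x \in (`]a, b[) /\ discontinuity F x].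
  by apply: discontinuity_countable => ? ? _ _; exact: ndF.
rewrite (_ : [set _ | _] = `]a, b[%classic).
  move=> /countable_lebesgue_measure0/eqP.
  rewrite lebesgue_measure_itv/= lte_fin ab -EFinB eqe subr_eq0.
  by rewrite gt_eqF.
apply/seteqP; split => x /=; first by case.
move=> xab; split=> //; apply: contrapT => nd.
by case: (nocont x) => [//|]; apply; exact: nondecreasing_continuous_at nd.
Qed.

(** If [G x < F x], their midpoint separates [G] from [F] just to the right of [x], where the
    hypothesis supplies a point [z]. *)
Lemma le_at_right (R : realFieldType) (F G : R -> R) (x : R) :
  F @ x^'+ --> F x -> G @ x^'+ --> G x ->
  (forall y, x < y -> exists2 z, z \in `]x, y[ & F z <= G z) -> F x <= G x.
Proof.
move=> cF cG FG; rewrite leNgt; apply/negP => GF.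
have : \forall y \near x^'+, G y < F y.
  near=> y; apply: (@lt_trans _ _ ((G x + F x) / 2)).
    by near: y; apply: (cvgr_lt _ cG); rewrite midf_lt.
  by near: y; apply: (cvgr_gt _ cF); rewrite midf_lt.
rewrite near_withinE => /nbhs_ballP[e /= e0 xe].
have [|z] := FG (x + e); first by rewrite ltrDl.
rewrite in_itv/= => /andP[xz zxe]; rewrite leNgt xe//.
by rewrite /ball/= ltr_distlC (lt_trans _ xz) ?zxe// gtrBl.
Unshelve. all: by end_near. Qed.

Section distr_fun.
Context (R : realType).
Implicit Types P Q : borel_prob R.

(** Under [P] the identity is a random variable of law [P], so facts about [cdf] transfer to
    [distr_fun P]. *)
Let id_rv : measurableTypeR R -> R := idfun.

#[local] HB.instance Definition _ :=
  @isMeasurableFun.Build _ _ _ _ id_rv (@measurable_id _ _ setT).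

Lemma distr_fun_nondecreasing P : nondecreasing_fun (distr_fun P).
Proof.
move=> x y xy; rewrite fine_le ?fin_num_measure//.
exact: (cdf_nondecreasing (id_rv : {RV P >-> R})).
Qed.

Lemma distr_fun_right_continuous P : right_continuous (distr_fun P).
Proof.
move=> a; apply: (@fine_cvg _ _ _ _ (cdf (id_rv : {RV P >-> R}))).
rewrite fineK ?fin_num_measure//; exact: cdf_right_continuous.
Qed.

Lemma cvg_distr_funy1 P : distr_fun P @ +oo --> (1 : R).
Proof. exact/fine_cvg/(cvg_cdfy1 (id_rv : {RV P >-> R})). Qed.

Lemma distr_fun_le1 P x : distr_fun P x <= 1.
Proof.
by rewrite -lee_fin fineK ?fin_num_measure//; exact: probability_le1.
Qed.

Lemma distr_fun_mixture (t : {i01 R}) P Q x :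
  distr_fun (mixture t P Q) x =
  t%:num * distr_fun P x + (1 - t%:num) * distr_fun Q x.
Proof.
rewrite -[LHS]/(fine (mixture t P Q `]-oo, x])) mixtureE.
by rewrite -[P _]fineK ?fin_num_measure// -[Q _]fineK ?fin_num_measure.
Qed.

End distr_fun.

Section decreasing_to.
Context (R : realType) (P_ : nat -> borel_prob R) (P : borel_prob R).
Hypothesis decP : decreasing_to P_ P.

(** At continuity points of the limit, a nondecreasing sequence lies below its limit; right
    continuity extends this to every [x]. *)
Lemma decreasing_to_le n x : distr_fun (P_ n) x <= distr_fun P x.
Proof.
apply: le_at_right; [exact: distr_fun_right_continuous..|move=> y xy].
have [z zxy cz] := nondecreasing_continuity_dense (distr_fun_nondecreasing P) xy.
exists z => //; rewrite -(cvg_lim _ (decP.2 z cz))//.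
apply: (@nondecreasing_cvgn_le _ (fun n => distr_fun (P_ n) z)).
  by apply/nondecreasing_seqP => k; exact: decP.1.
exact: cvgP (decP.2 z cz).
Qed.

Lemma decreasing_to_le_lim (G : R -> R) (x y : R) :
  G @ x^'+ --> G x -> x < y ->
  (forall n z, z < y -> distr_fun (P_ n) z <= G z) -> distr_fun P x <= G x.
Proof.
move=> cG xy leG; apply: le_at_right => //; first exact: distr_fun_right_continuous.
move=> y' xy'.
(* The point must lie below [y] for [leG] to apply, and below [y'] to be close to [x]. *)
have [||z] := @nondecreasing_continuity_dense _ (distr_fun P) x (Num.min y y').
- exact: distr_fun_nondecreasing.
- by rewrite lt_min xy.
rewrite in_itv/= lt_min => /and3P[xz zy zy'] cz.
exists z; first by rewrite in_itv/= xz.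
rewrite -(cvg_lim _ (decP.2 z cz))//.
by apply: limr_le; [exact: cvgP (decP.2 z cz)|near=> n; exact: leG].
Unshelve. all: by end_near. Qed.

End decreasing_to.

Section admissible.
Context (R : realType) (L : R -> R).
Implicit Types P Q : borel_prob R.

Definition admissible P : set R :=
  [set m | forall x, x < m -> distr_fun P x <= L x].

(** From [m] on, [lvar_bound L m] is 1, which no distribution function exceeds; only points below
    [m] constrain. *)
Lemma LambdaVaRE P : LambdaVaR L P = (- ereal_sup (EFin @` admissible P))%E.
Proof.
rewrite /LambdaVaR; congr (- ereal_sup (_ @` _))%E.
apply/seteqP; split => m /= mP x.
  move=> xm; have := mP x; rewrite /lvar_bound !indicE !mem_setE/= !in_itv/=.
  by rewrite xm andbT [m <= x]leNgt xm mulr1 addr0.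
rewrite /lvar_bound !indicE !mem_setE/= !in_itv/= andbT.
have [xm|mx] := ltP x m; first by rewrite mulr1 addr0 mP.
by rewrite mulr0 add0r distr_fun_le1.
Qed.

Lemma admissible_down P (m m' : R) : m' <= m -> admissible P m -> admissible P m'.
Proof. by move=> m'm mP x xm'; apply/mP/(lt_le_trans xm'). Qed.

Lemma admissible_lt_sup P (m : R) :
  (m%:E < ereal_sup (EFin @` admissible P))%E -> admissible P m.
Proof.
move=> /ereal_sup_gt[_ [m' Pm' <-]]; rewrite lte_fin => /ltW mm'.
exact: admissible_down mm' Pm'.
Qed.

Lemma admissible_total P Q :
  admissible P `<=` admissible Q \/ admissible Q `<=` admissible P.
Proof.
have [|/existsNP[m /not_implyP[Pm Qm]]] := pselect (admissible P `<=` admissible Q).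
  by left.
right=> m' Qm'; apply: admissible_down Pm; rewrite leNgt; apply/negP => mm'.
by apply: Qm; exact: admissible_down (ltW mm') Qm'.
Qed.

(** At each [x], a convex combination of two values below the same threshold [L x] stays below
    it. *)
Lemma admissible_mixture (t : {i01 R}) P Q :
  admissible P `&` admissible Q `<=` admissible (mixture t P Q).
Proof.
move=> m [Pm Qm] x xm; rewrite distr_fun_mixture.
have -> : L x = t%:num * L x + (1 - t%:num) * L x by rewrite -mulrDl addrC subrK mul1r.
by rewrite lerD// ler_wpM2l ?Pm ?Qm// subr_ge0.
Qed.

Lemma LambdaVaR_anti P Q :
  admissible P `<=` admissible Q -> (LambdaVaR L Q <= LambdaVaR L P)%E.
Proof.
by move=> PQ; rewrite !LambdaVaRE leeN2; apply/ereal_sup_le/image_subset.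
Qed.

Lemma LambdaVaR_fosd P Q : fosd P Q -> (LambdaVaR L Q <= LambdaVaR L P)%E.
Proof.
by move=> PQ; apply: LambdaVaR_anti => m Pm x /Pm; exact/le_trans/PQ.
Qed.

Lemma LambdaVaR_quasiconvex (t : {i01 R}) P Q :
  (LambdaVaR L (mixture t P Q) <= maxe (LambdaVaR L P) (LambdaVaR L Q))%E.
Proof.
rewrite le_max; have [PQ|QP] := admissible_total P Q; apply/orP; [left|right].
  by apply: LambdaVaR_anti => m Pm; apply: admissible_mixture; split=> //; exact: PQ.
by apply: LambdaVaR_anti => m Pm; apply: admissible_mixture; split=> //; exact: QP.
Qed.

(** A point where [F_P] exceeds [L] bounds every admissible [m] from above. *)
Lemma LambdaVaR_gtNy P x : L x < distr_fun P x -> (-oo < LambdaVaR L P)%E.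
Proof.
move=> LP; rewrite LambdaVaRE lteNr/=.
apply: (@le_lt_trans _ _ x%:E); last exact: ltry.
apply: ge_ereal_sup => _ [m Pm <-]; rewrite lee_fin leNgt; apply/negP => /Pm.
by rewrite leNgt LP.
Qed.

(** [F_P] tends to 1 at infinity, so it eventually passes [c]. *)
Lemma distr_fun_crossing P (c y : R) : c < 1 -> (forall x, y <= x -> L x <= c) ->
  exists x, L x < distr_fun P x.
Proof.
move=> c1 Lc; near (+oo : set_system R) => x; exists x.
apply: (@le_lt_trans _ _ c).
  by apply: Lc; near: x; apply: nbhs_pinfty_ge; exact: num_real.
by near: x; apply: (cvgr_gt _ (@cvg_distr_funy1 _ P)).
Unshelve. all: by end_near. Qed.

Lemma LambdaVaR_cvg (P_ : nat -> borel_prob R) P :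
  right_continuous L -> decreasing_to P_ P ->
  LambdaVaR L (P_ n) @[n --> \oo] --> LambdaVaR L P.
Proof.
move=> Lrc decP.
have nd : nondecreasing_seq (fun n => LambdaVaR L (P_ n)).
  by apply/nondecreasing_seqP => n; apply: LambdaVaR_fosd => x; exact: decP.1.
suff <- : ereal_sup (range (fun n => LambdaVaR L (P_ n))) = LambdaVaR L P.
  exact: ereal_nondecreasing_cvgn.
apply/eqP; rewrite eq_le; apply/andP; split.
  apply: ge_ereal_sup => _ [n _ <-]; apply: LambdaVaR_fosd => x.
  exact: decreasing_to_le.
(* After negation the left side is the infimum over [n] of the suprema for [P_ n]. Taking [m]
   strictly below it makes [m] admissible for every [P_ n]. *)
rewrite LambdaVaRE leeNl; apply: lee_from_below => m mS.
apply: ereal_sup_ubound; exists m => // x xm.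
apply: (decreasing_to_le_lim decP (Lrc x) xm) => n; apply: admissible_lt_sup.
apply: (lt_le_trans mS); rewrite leeNl -LambdaVaRE.
by apply: ereal_sup_ubound; exists n.
Qed.

End admissible.

Theorem mainTheorem6 (R : realType) (L : R -> R)
    (L01 : forall x, 0 <= L x <= 1)
    (Lrc : right_continuous L)
    (Lmon : (nondecreasing_fun L /\ sup (range L) < 1) \/
            (nonincreasing_fun L /\ inf (range L) < 1)) :
  [/\ forall P : borel_prob R, (-oo < LambdaVaR L P)%E,
      forall P Q : borel_prob R,
        fosd P Q -> (LambdaVaR L Q <= LambdaVaR L P)%E,
      forall (t : {i01 R}) (P Q : borel_prob R),
        (LambdaVaR L (mixture t P Q) <=
         maxe (LambdaVaR L P) (LambdaVaR L Q))%E &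
      forall (P_ : nat -> borel_prob R) (P : borel_prob R),
        decreasing_to P_ P ->
        (forall n, (LambdaVaR L (P_ n) <= LambdaVaR L (P_ n.+1))%E) /\
        (LambdaVaR L (P_ n) @[n --> \oo] --> LambdaVaR L P)].
Proof.
split; [move=> P|exact: LambdaVaR_fosd|exact: LambdaVaR_quasiconvex|].
  suff [c [y c1 Lc]] : exists c, exists2 y, c < 1 & forall x, y <= x -> L x <= c.
    by have [x] := distr_fun_crossing P c1 Lc; exact: LambdaVaR_gtNy.
  case: Lmon => [[_ supL]|[niL infL]].
    (* The bound holds on the whole line, so the starting point 0 is arbitrary; [L <= 1] makes [sup]
       a genuine upper bound. *)
    exists (sup (range L)), 0 => // x _; apply: ub_le_sup; last by exists x.
    by exists 1 => _ [z _ <-]; have /andP[] := L01 z.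
  (* Some value [L y] is below 1, and a decreasing [L] stays below it from [y] on. *)
  have [|_ [y _ <-] Ly1] := inf_lt _ infL; first by exists (L 0), 0.
  by exists (L y), y => // x; exact: niL.
move=> P_ P decP; split; last exact: LambdaVaR_cvg.
by move=> n; apply: LambdaVaR_fosd => x; exact: decP.1.
Qed.
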